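(* Let $Y\subseteq X$. If $Y$ is a submonoid of $X\cup[V(B)]$, then $I(Y)$ is a binomial ideal. If $Y\subseteq T_X$ is a submonoid (of $T_X$), then $I(Y)$ is a lattice ideal, i.e. $I(Y)=I_L$ for some lattice $L\subseteq\mathbb Z^r$.
   Context: Setting. $X$ is a complete simplicial toric variety over a field $\mathbb K$ given by a fan $\Sigma\subset\mathbb R^n$ with rays $\rho_1,\dots,\rho_r$ and corresponding primitive lattice generators $\mathbf v_1,\dots,\mathbf v_r\in\mathbb Z^n$. The matrix $\phi:\mathbb Z^n\to\mathbb Z^r$ has rows $\mathbf v_1,\dots,\mathbf v_r$, and there is an exact sequence $0\to\mathbb Z^n\xrightarrow{\phi}\mathbb Z^r\xrightarrow{\beta}\mathcal A\to 0$ with $\mathcal A\cong \mathrm{Cl}(X)$. The Cox ring $S=\mathbb K[x_1,\dots,x_r]$ is graded by $\mathcal A$ via $\deg x_j=\beta_j:=\beta(e_j)$; ''homogeneous'' refers to this grading. Let $\mathbf u_1,\dots,\mathbf u_n\in\mathbb Z^r$ be the columns of $\phi$, write $\mathbf t^{\mathbf u}=t_1^{u_1}\cdots t_r^{u_r}$, let $\pi:(\mathbb K^* )^r\to T_X\cong(\mathbb K^* )^n$, $\pi(\mathbf t)=(\mathbf t^{\mathbf u_1},\dots,\mathbf t^{\mathbf u_n})$, and $G=\ker\pi$. The torus $T_X$ is split and $1\to G\to(\mathbb K^* )^r\xrightarrow{\pi}T_X\to1$ is assumed exact, so $T_X=(\mathbb K^* )^r/G$. The irrelevant ideal is $B=\langle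 \prod_{\rho_i\notin\sigma}x_i : \sigma\in\Sigma\rangle$; the order of the torsion part of $\mathcal A$ is assumed coprime to the characteristic of $\mathbb K$, and points of $X$ are identified with orbits: $X=(\mathbb K^r\setminus V(B))/G$, with $[P]=G\cdot P$ (coordinatewise action). $[V(B)]$ denotes the set of orbits $[P]$ with $P\in V(B)\subset\mathbb K^r$. The product $[P]\cdot[P']:=[PP']$ (coordinatewise) makes $X\cup[V(B)]$ a monoid with identity $[1]=[1:\cdots:1]$. For $Y\subseteq X$, $I(Y)\subseteq S$ is the ideal generated by the homogeneous polynomials vanishing on $Y$. A binomial is a difference $\mathbf x^{\mathbf a}-\mathbf x^{\mathbf b}$ of two monomials, and a binomial ideal is an ideal generated by binomials. A lattice is a subgroup $L\subseteq\mathbb Z^r$; writing $\mathbf m=\mathbf m^+-\mathbf m^-$ with $\mathbf m^{\pm}\in\mathbb N^r$ the positive and negative parts, its lattice ideal is $I_L=\langle \mathbf x^{\mathbf m^+}-\mathbf x^{\mathbf m^-} : \mathbf m\in L\rangle$. *)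

(* Defs.v *)
From HB Require Import structures.
From mathcomp Require Import all_boot all_order all_algebra.
From mathcomp Require Import boolp classical_sets cardinality reals.
From mathcomp Require Import mpoly.

Set Implicit Arguments.
Unset Strict Implicit.
Unset Printing Implicit Defensive.

Import Order.TTheory GRing.Theory Num.Theory.

Local Open Scope classical_set_scope.
Local Open Scope ring_scope.

Section Fans.
Variables (R : realType) (n : nat).
Implicit Types C F : set 'rV[R]_n.

(* The cone in R^n spanned by the rows of an integer matrix. *)
Definition cone_of k (M : 'M[int]_(k, n)) : set 'rV[R]_n :=
  [set x | exists2 c : 'rV[R]_k,
     (forall i, 0 <= c 0 i) & x = c *m map_mx intr M].

Definition rational_polyhedral C : Prop :=
  exists k (M : 'M[int]_(k, n)), C = cone_of M.

Definition strongly_convex C : Prop :=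
  forall x, C x -> C (- x) -> x = 0.

(* [u] is a linear form, nonnegative on [C], cutting out the face [F]. *)
Definition is_face F C : Prop :=
  exists2 u : 'cV[R]_n,
    (forall x, C x -> 0 <= (x *m u) 0 0)
    & F = C `&` [set x | (x *m u) 0 0 = 0].

Record is_fan (Sigma : set (set 'rV[R]_n)) : Prop := IsFan {
  fan_finite : finite_set Sigma;
  fan_rational : forall C, Sigma C -> rational_polyhedral C;
  fan_convex : forall C, Sigma C -> strongly_convex C;
  fan_face : forall C F, Sigma C -> is_face F C -> Sigma F;
  fan_meet : forall C C', Sigma C -> Sigma C' ->
    is_face (C `&` C') C /\ is_face (C `&` C') C' }.

Definition simplicial_cone C : Prop :=
  exists k (M : 'M[int]_(k, n)),
    row_free (map_mx intr M : 'M[R]_(k, n)) /\ C = cone_of M.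

Definition simplicial_fan (Sigma : set (set 'rV[R]_n)) : Prop :=
  forall C, Sigma C -> simplicial_cone C.

Definition complete_fan (Sigma : set (set 'rV[R]_n)) : Prop :=
  forall x, exists2 C, Sigma C & C x.

Definition primitive (u : 'rV[int]_n) : Prop :=
  \big[gcdn/0%N]_(j < n) absz (u 0 j) = 1%N.

(* The rows of [v] list, without repetition, the primitive generators of all
   the rays of [Sigma]. *)
Record ray_generators (Sigma : set (set 'rV[R]_n)) r (v : 'M[int]_(r, n)) :
    Prop := RayGenerators {
  ray_primitive : forall i, primitive (row i v);
  ray_inj : injective (fun i => row i v);
  ray_all : forall u, primitive u ->
    (Sigma (cone_of u) <-> exists i, u = row i v) }.

End Fans.

(* 0 -> Z^n -> Z^r -> A -> 0, the first map being multiplication by [phi]. *)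
Definition class_group_sequence n r (phi : 'M[int]_(r, n)) (A : zmodType)
    (beta : {additive 'cV[int]_r -> A}) : Prop :=
  [/\ injective (fun m : 'cV[int]_n => phi *m m),
      forall w, beta w = 0 <-> exists m : 'cV[int]_n, w = phi *m m
    & forall a, exists w, beta w = a].

Definition torsion (A : zmodType) : set A :=
  [set a | exists2 k, (0 < k)%N & a *+ k = 0].
Arguments torsion A : clear implicits.

(* In characteristic 0 the set [pchar K] is empty: there is no condition. *)
Definition torsion_coprime_char (A : zmodType) (K : fieldType) : Prop :=
  exists N, (torsion A #= `I_N)%card /\ forall p, p \in [pchar K] -> coprime N p.

Section Ideals.
Variables (K : fieldType) (r : nat).
Local Notation S := {mpoly K[r]}.

Definition ideal_gen (F : set S) : set S :=
  [set p | exists2 s : seq (S * S),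
     (forall q, q \in s -> F q.2) & p = \sum_(q <- s) q.1 * q.2].

Definition binomial (p : S) : Prop := exists a b : 'X_{1..r}, p = 'X_[a] - 'X_[b].

Definition binomial_ideal (I : set S) : Prop :=
  exists2 F : set S, F `<=` binomial & I = ideal_gen F.

Definition is_lattice (L : set 'cV[int]_r) : Prop :=
  L 0 /\ forall x y, L x -> L y -> L (x - y).

Definition pos_part (m : 'cV[int]_r) : 'X_{1..r} :=
  [multinom absz (Num.max (m i 0) 0)%R | i < r].

Definition neg_part (m : 'cV[int]_r) : 'X_{1..r} :=
  [multinom absz (Num.max (- m i 0) 0)%R | i < r].

Definition lattice_ideal (L : set 'cV[int]_r) : set S :=
  ideal_gen [set 'X_[pos_part m] - 'X_[neg_part m] | m in L].

Section Grading.
Variables (A : zmodType) (beta : {additive 'cV[int]_r -> A}).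

Definition cox_degree (m : 'X_{1..r}) : A :=
  \sum_(i < r) beta (delta_mx i 0) *+ m i.

Definition cox_homogeneous (f : S) : Prop :=
  exists a, forall m, m \in msupp f -> cox_degree m = a.

End Grading.
End Ideals.

Section Torus.
Variables (K : fieldType).

Definition torus k : set {ffun 'I_k -> K} := [set t | forall i, t i != 0].

Definition laurent_monomial r (t : {ffun 'I_r -> K}) (u : 'cV[int]_r) : K :=
  \prod_(i < r) t i ^ u i 0.

Variables (n r : nat) (phi : 'M[int]_(r, n)).

Definition torus_proj (t : {ffun 'I_r -> K}) : {ffun 'I_n -> K} :=
  [ffun j => laurent_monomial t (col j phi)].

(* With the kernel of [torus_proj] taken as [G] below, this is the exactness
   of 1 -> G -> (K^* )^r -> (K^* )^n -> 1. *)
Definition torus_proj_surjective : Prop :=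
  forall s, torus s -> exists2 t, torus t & torus_proj t = s.

Definition cox_group : set {ffun 'I_r -> K} :=
  [set t | torus t /\ torus_proj t = 1].

(* [P] = G . P; products of points are coordinatewise. *)
Definition orbit_of (P : {ffun 'I_r -> K}) : set {ffun 'I_r -> K} :=
  [set g * P | g in cox_group].

Definition orbit_mul (O O' : set {ffun 'I_r -> K}) : set {ffun 'I_r -> K} :=
  [set P * Q | P in O & Q in O'].

Lemma cox_group1 : cox_group 1.
Proof.
split=> [i|]; first by rewrite ffunE oner_neq0.
apply/ffunP=> j; rewrite !ffunE /laurent_monomial.
by apply: big1 => i _; rewrite ffunE exp1rz.
Qed.

Lemma cox_groupM g h : cox_group g -> cox_group h -> cox_group (g * h).
Proof.
move=> [gT g1] [hT h1]; split=> [i|]; first by rewrite ffunE mulf_neq0.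
rewrite -[1]mulr1 -{1}g1 -h1; apply/ffunP=> j.
rewrite !ffunE /laurent_monomial -big_split /=.
apply: eq_bigr => i _; rewrite ffunE exprzMl //.
- by rewrite unitfE; apply: gT.
- by rewrite unitfE; apply: hT.
Qed.

Lemma orbit_mulE P Q : orbit_mul (orbit_of P) (orbit_of Q) = orbit_of (P * Q).
Proof.
apply/seteqP; split=> x.
- move=> [_ [g Gg <-]] [_ [h Gh <-]] <-.
  by exists (g * h); [apply: cox_groupM | apply/ffunP=> i; rewrite !ffunE mulrACA].
- move=> [g Gg <-]; exists (g * P); first by exists g.
  exists (1 * Q); first by exists 1 => //; apply: cox_group1.
  by rewrite mul1r mulrA.
Qed.

(* A submonoid of a set [M] of orbits; the identity is [1 : ... : 1]. *)
Definition is_submonoid (M Y : set (set {ffun 'I_r -> K})) : Prop :=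
  [/\ Y `<=` M, Y (orbit_of 1)
    & forall O O', Y O -> Y O' -> Y (orbit_mul O O')].

Definition torus_orbits : set (set {ffun 'I_r -> K}) :=
  [set orbit_of t | t in @torus r].

Definition vanishes_on (f : {mpoly K[r]}) (Y : set (set {ffun 'I_r -> K})) :
    Prop :=
  forall O P, Y O -> O P -> f.@[P] = 0.

Definition vanishing_ideal (A : zmodType) (beta : {additive 'cV[int]_r -> A})
    (Y : set (set {ffun 'I_r -> K})) : set {mpoly K[r]} :=
  ideal_gen [set f | cox_homogeneous beta f /\ vanishes_on f Y].

Variables (R : realType) (Sigma : set (set 'rV[R]_n)).

Definition irrelevant_ideal : set {mpoly K[r]} :=
  ideal_gen [set \prod_(i < r | `[< ~ is_face (cone_of (row i phi)) C >]) 'X_i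
            | C in Sigma].

Definition irrelevant_locus : set {ffun 'I_r -> K} :=
  [set P | forall f, irrelevant_ideal f -> f.@[P] = 0].

Definition irrelevant_orbits : set (set {ffun 'I_r -> K}) :=
  [set orbit_of P | P in irrelevant_locus].

(* The K-points of X, as G-orbits in K^r \ V(B). *)
Definition toric_points : set (set {ffun 'I_r -> K}) :=
  [set orbit_of P | P in ~` irrelevant_locus].

End Torus.

Arguments torus K k : clear implicits.
Arguments cox_group K {n r} phi.
Arguments torus_orbits K {n r} phi.
Arguments irrelevant_ideal K {n r} phi {R} Sigma.
Arguments irrelevant_locus K {n r} phi {R} Sigma.
Arguments irrelevant_orbits K {n r} phi {R} Sigma.
Arguments toric_points K {n r} phi {R} Sigma.
Arguments lattice_ideal K {r} L.

(* Main.v *)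
Require Import Defs.
From HB Require Import structures.
From mathcomp Require Import all_boot all_order all_algebra.
From mathcomp Require Import boolp classical_sets cardinality reals.
From mathcomp Require Import mpoly ring zify.

Set Implicit Arguments.
Unset Strict Implicit.
Unset Printing Implicit Defensive.

Import Order.TTheory GRing.Theory Num.Theory.

Local Open Scope classical_set_scope.
Local Open Scope ring_scope.

(** The points lying on the orbits of [Y] form a multiplicative submonoid [M]
    of K^r, and a monomial restricts to a character of [M], that is, to a
    multiplicative map M -> K with value 1 at 1.  By Dedekind's argument
    distinct characters are linearly independent
    ([character_coefficient_eq0]), so if a polynomial vanishes on [M], then for
    each character the coefficients of the monomials restricting to it add up
    to 0.  Such a polynomial is therefore a linear combination of differences
    x^a - x^b of two of its own monomials with the same restriction
    ([vanishing_sum_in_ideal]).  If the polynomial is homogeneous, then so is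
    each of these differences, and it vanishes on [Y].  Hence I(Y) is generated
    by the homogeneous binomials that vanish on [Y]
    ([vanishing_ideal_binomials]), which is the first assertion.

    If [M] lies in the torus, the binomial x^a - x^b is homogeneous and
    vanishes on [Y] exactly when a - b lies in the group L of exponents m
    with beta(m) = 0 and t^m = 1 for all t in [M].  Dividing x^a - x^b by the
    greatest common divisor of its two terms leaves the generator of the
    lattice ideal attached to m = a - b, so I(Y) = I_L
    ([toric_vanishing_ideal]). *)

(** * Ideals generated by a set of polynomials *)

Section GeneratedIdeals.
Variables (K : fieldType) (r : nat).
Local Notation S := {mpoly K[r]}.
Implicit Types (F G : set S) (p q : S).

Lemma ideal_gen_mem F p : F p -> ideal_gen F p.
Proof.
move=> Fp; exists [:: (1, p)]; last by rewrite big_seq1 mul1r.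
by move=> q; rewrite inE => /eqP ->.
Qed.

Lemma ideal_gen0 F : ideal_gen F 0.
Proof. by exists [::]; rewrite ?big_nil. Qed.

Lemma ideal_genD F p q : ideal_gen F p -> ideal_gen F q -> ideal_gen F (p + q).
Proof.
move=> [s sF ->] [t tF ->]; exists (s ++ t); last by rewrite big_cat.
by move=> x; rewrite mem_cat => /orP[/sF|/tF].
Qed.

Lemma ideal_genMl F p q : ideal_gen F q -> ideal_gen F (p * q).
Proof.
move=> [s sF ->]; exists [seq (p * x.1, x.2) | x <- s].
  by move=> _ /mapP[x xs ->]; exact: (sF x xs).
by rewrite big_map mulr_sumr; apply: eq_bigr => x _; rewrite mulrA.
Qed.

Lemma ideal_genZ F c p : ideal_gen F p -> ideal_gen F (c *: p).
Proof. by rewrite -mul_mpolyC; apply: ideal_genMl. Qed.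

Lemma ideal_gen_sum F (I : eqType) (s : seq I) (E : I -> S) :
  (forall i, i \in s -> ideal_gen F (E i)) -> ideal_gen F (\sum_(i <- s) E i).
Proof.
elim: s => [|i s IHs] sF; first by rewrite big_nil; apply: ideal_gen0.
rewrite big_cons; apply: ideal_genD; first by apply: sF; rewrite mem_head.
by apply: IHs => j js; apply: sF; rewrite inE js orbT.
Qed.

Lemma ideal_gen_min F G : F `<=` ideal_gen G -> ideal_gen F `<=` ideal_gen G.
Proof.
move=> FG _ [s sF ->]; apply: ideal_gen_sum => q /sF Fq.
exact/ideal_genMl/FG.
Qed.

Lemma ideal_gen_eq F G :
  F `<=` ideal_gen G -> G `<=` ideal_gen F -> ideal_gen F = ideal_gen G.
Proof. by move=> FG GF; apply/seteqP; split; apply: ideal_gen_min. Qed.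

End GeneratedIdeals.

(** * Independence of characters of a monoid *)

(** The inductive step is Dedekind's: if chi_b(y) <> chi_a(y), subtract
    chi_b(y) times the relation at x from the relation at x y.  The term of b
    cancels, and the coefficient of chi_a is multiplied by the nonzero factor
    chi_a(y) - chi_b(y). *)
Lemma character_coefficient_eq0 (T : Type) (I : eqType) (mul : T -> T -> T)
    (one : T) (M : set T) (K : fieldType) (chi : I -> T -> K) (a : I) :
  M one -> (forall x y, M x -> M y -> M (mul x y)) ->
  (forall i x y, chi i (mul x y) = chi i x * chi i y) -> chi a one = 1 ->
  forall (s : seq I) (c0 : K) (c : I -> K),
  (forall b, b \in s -> exists2 y, M y & chi b y != chi a y) ->
  (forall x, M x -> c0 * chi a x + \sum_(b <- s) c b * chi b x = 0) ->
  c0 = 0.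
Proof.
move=> M1 MM chiM chi1; elim=> [|b s IHs] c0 c s_neq rel.
  by have := rel _ M1; rewrite big_nil addr0 chi1 mulr1.
have [y My neq_y] := s_neq b (mem_head b s).
have /eqP: c0 * (chi a y - chi b y) = 0; last first.
  by rewrite mulf_eq0 subr_eq0 [_ == chi b y]eq_sym (negPf neq_y) orbF => /eqP.
apply: (IHs _ (fun i => c i * (chi i y - chi b y))) => [i si|x Mx].
  by apply: s_neq; rewrite inE si orbT.
have -> : \sum_(i <- s) c i * (chi i y - chi b y) * chi i x =
    \sum_(i <- s) c i * chi i (mul x y)
    - chi b y * \sum_(i <- s) c i * chi i x.
  rewrite mulr_sumr -sumrB; apply: eq_bigr => i _.
  by rewrite chiM; ring.
have := congr2 (fun u v => u - chi b y * v) (rel _ (MM _ _ Mx My)) (rel _ Mx).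
rewrite !big_cons mulr0 subr0 => rel_b.
by rewrite -[RHS]rel_b !chiM; ring.
Qed.

(** * Polynomials vanishing on a monoid of points *)

Section MonoidOfPoints.
Variables (K : fieldType) (r : nat).
Implicit Types (P Q : {ffun 'I_r -> K}) (a b : 'X_{1..r}).

Lemma monomial_eval1 a : 'X_[a].@[(1 : {ffun 'I_r -> K})] = 1.
Proof. by rewrite mevalX big1 // => i _; rewrite ffunE expr1n. Qed.

Lemma monomial_evalM a P Q : 'X_[a].@[P * Q] = 'X_[a].@[P] * 'X_[a].@[Q].
Proof.
rewrite !mevalX -big_split; apply: eq_bigr => i _ /=.
by rewrite ffunE exprMn.
Qed.

(** The first term x^a of the sum selects the terms whose monomials have the
    same restriction to [M] as x^a.  Their coefficients add up to 0, so
    replacing each of these monomials by x^a changes their sum to 0; the other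
    terms form a shorter sum that still vanishes on [M]. *)
Lemma vanishing_sum_in_ideal (M : set {ffun 'I_r -> K})
    (F : set {mpoly K[r]}) (s : seq 'X_{1..r}) (c : 'X_{1..r} -> K) :
  M 1 -> (forall P Q, M P -> M Q -> M (P * Q)) ->
  (forall a b, a \in s -> b \in s ->
     (forall P, M P -> 'X_[K, a].@[P] = 'X_[K, b].@[P]) ->
     F ('X_[a] - 'X_[b])) ->
  (forall P, M P -> (\sum_(a <- s) c a *: 'X_[K, a]).@[P] = 0) ->
  ideal_gen F (\sum_(a <- s) c a *: 'X_[a]).
Proof.
move=> M1 MM; have [k] := ubnP (size s).
elim: k s => // k IHk [|a s] /= size_s sF s_vanish.
  by rewrite big_nil; apply: ideal_gen0.
pose e b := `[< forall P, M P -> 'X_[K, b].@[P] = 'X_[K, a].@[P] >].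
have e_a : e a by apply/asboolP.
have e_eval b P : e b -> M P -> 'X_[b].@[P] = 'X_[a].@[P].
  by move=> /asboolP; apply.
rewrite (bigID e) /= -[X in _ + X]big_filter.
set t := [seq b <- a :: s | ~~ e b].
have t_sub b : b \in t -> b \in a :: s by rewrite mem_filter => /andP[].
have split_eval P : M P -> (\sum_(b <- a :: s | e b) c b) * 'X_[a].@[P]
    + \sum_(b <- t) c b * 'X_[b].@[P] = 0.
  move=> MP; rewrite -[RHS](s_vanish P MP) [in RHS](bigID e) /=.
  rewrite -[X in _ = (_ + X).@[_]]big_filter mevalD !raddf_sum /= mulr_suml.
  congr (_ + _); last by apply: eq_bigr => b _; rewrite mevalZ.
  by apply: eq_bigr => b eb; rewrite mevalZ (e_eval b P eb MP).
have sum_c0 : \sum_(b <- a :: s | e b) c b = 0.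
  apply: (character_coefficient_eq0 M1 MM _ _ _ split_eval).
  - by move=> b P Q; apply: monomial_evalM.
  - exact: monomial_eval1.
  - move=> b; rewrite mem_filter => /andP[/asboolPn].
    by move=> /existsNP[P /not_implyP[MP /eqP neqP]] _; exists P.
apply: ideal_genD.
  have -> : \sum_(b <- a :: s | e b) c b *: 'X_[K, b]
      = \sum_(b <- a :: s | e b) c b *: ('X_[b] - 'X_[a]).
    under [RHS]eq_bigr do rewrite scalerBr.
    by rewrite sumrB -scaler_suml sum_c0 scale0r subr0.
  rewrite -big_filter; apply: ideal_gen_sum => b.
  rewrite mem_filter => /andP[eb b_in]; apply/ideal_genZ/ideal_gen_mem.
  by apply: sF => [||P MP]; rewrite ?mem_head ?e_eval.
apply: IHk => [|b b' /t_sub bt /t_sub b't|P MP].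
- rewrite /t /= e_a /=; apply: leq_ltn_trans (size_s : size s < k)%N.
  by rewrite size_filter count_size.
- exact: sF.
- rewrite -[RHS](split_eval P MP) sum_c0 mul0r add0r raddf_sum.
  by apply: eq_bigr => b _; apply: mevalZ.
Qed.

End MonoidOfPoints.

Section OrbitMonoid.
Variables (K : fieldType) (n r : nat) (phi : 'M[int]_(r, n)).
Variables (A : zmodType) (beta : {additive 'cV[int]_r -> A}).
Variables (N Y : set (set {ffun 'I_r -> K})).
Hypothesis Y_monoid : is_submonoid phi N Y.

Lemma orbit_points1 : (\bigcup_(O in Y) O) 1.
Proof.
case: Y_monoid => _ Y1 _; exists (orbit_of phi 1) => //.
by exists 1; rewrite ?mulr1 //; apply: cox_group1.
Qed.

Lemma orbit_pointsM P Q : (\bigcup_(O in Y) O) P -> (\bigcup_(O in Y) O) Q ->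
  (\bigcup_(O in Y) O) (P * Q).
Proof.
case: Y_monoid => _ _ YM [O YO OP] [O' YO' OQ].
by exists (orbit_mul O O'); [apply: YM | exists P => //; exists Q].
Qed.

(** When a = b the binomial is zero and its support says nothing about the
    degree of x^a, so this case is treated apart. *)
Lemma binomial_homogeneousP a b :
  cox_homogeneous beta ('X_[K, a] - 'X_[b]) <->
  cox_degree beta a = cox_degree beta b.
Proof.
split=> [[d hd]|eq_ab]; last first.
  exists (cox_degree beta b) => m /msuppB_le.
  by rewrite !msuppX mem_cat !inE => /orP[/eqP->|/eqP->].
have [->//|neq_ab] := eqVneq a b.
by rewrite !hd // mcoeff_msupp mcoeffB !mcoeffX eqxx ?[b == a]eq_sym
  (negPf neq_ab) ?sub0r ?subr0 ?oppr_eq0 oner_neq0.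
Qed.

Lemma binomial_vanishesP a b :
  vanishes_on ('X_[a] - 'X_[b]) Y <->
  (forall P, (\bigcup_(O in Y) O) P -> 'X_[K, a].@[P] = 'X_[b].@[P]).
Proof.
split=> [van P [O YO OP]|eq_ab O P YO OP].
  by apply/eqP; rewrite -subr_eq0 -mevalB (van O P).
by rewrite mevalB eq_ab ?subrr //; exists O.
Qed.

(** The binomials produced from a homogeneous polynomial [f] are differences of
    monomials of [f], hence of equal degree; this is what keeps them among the
    homogeneous generators. *)
Lemma vanishing_ideal_binomials :
  vanishing_ideal beta Y =
  ideal_gen [set f |
    [/\ Defs.binomial f, cox_homogeneous beta f & vanishes_on f Y]].
Proof.
apply: ideal_gen_eq => [f [[d hd] f_van]|f [_ hf f_van]]; last first.
  exact: ideal_gen_mem.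
rewrite [f]mpolyE; apply: vanishing_sum_in_ideal orbit_points1 orbit_pointsM _ _.
- move=> a b af bf eq_ab; split; first by exists a, b.
  + by apply/binomial_homogeneousP; rewrite !hd.
  + exact/binomial_vanishesP.
- by move=> P [O YO OP]; rewrite -mpolyE; apply: f_van OP.
Qed.

End OrbitMonoid.

(** * Exponents of monomials as integer vectors *)

Section Exponents.
Variable r : nat.
Implicit Types (a b : 'X_{1..r}) (m : 'cV[int]_r).

Definition exponent_vector a : 'cV[int]_r := \col_i (a i)%:Z.

Lemma cox_degreeE (A : zmodType) (beta : {additive 'cV[int]_r -> A}) a :
  cox_degree beta a = beta (exponent_vector a).
Proof.
rewrite /cox_degree [exponent_vector a]matrix_sum_delta raddf_sum.
apply: eq_bigr => i _; rewrite big_ord1 !mxE -raddfMn; congr (beta _).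
by rewrite -scaler_nat natz.
Qed.

Lemma pos_neg_partK m :
  exponent_vector (pos_part m) - exponent_vector (neg_part m) = m.
Proof.
apply/matrixP=> i j; rewrite ord1 !mxE !mnmE.
move: (m i 0) => z; case: (leP z 0); case: (leP (- z) 0); lia.
Qed.

(** The greatest common divisor of x^a and x^b, with exponents min(a_i, b_i),
    is split off. *)
Lemma binomial_factor (K : fieldType) a b :
  exists c, let m := exponent_vector a - exponent_vector b in
  'X_[K, a] - 'X_[b] = 'X_[c] * ('X_[pos_part m] - 'X_[neg_part m]).
Proof.
exists [multinom minn (a i) (b i) | i < r] => m.
rewrite mulrBr -!mpolyXD; congr ('X_[_] - 'X_[_]).
all: by apply/mnmP=> i; rewrite mnmDE !mnmE /m !mxE; case: leP; lia.
Qed.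

Lemma laurent_monomialB (K : fieldType) (t : {ffun 'I_r -> K}) m m' :
  torus K r t ->
  laurent_monomial t (m - m') = laurent_monomial t m / laurent_monomial t m'.
Proof.
move=> tT; rewrite /laurent_monomial -prodfV -big_split; apply: eq_bigr => i _ /=.
by rewrite !mxE expfzDr ?tT // -invr_expz.
Qed.

Lemma laurent_exponent_vector (K : fieldType) (t : {ffun 'I_r -> K}) a :
  laurent_monomial t (exponent_vector a) = 'X_[a].@[t].
Proof. by rewrite mevalX; apply: eq_bigr => i _; rewrite mxE. Qed.

Lemma laurent_monomial_neq0 (K : fieldType) (t : {ffun 'I_r -> K}) m :
  torus K r t -> laurent_monomial t m != 0.
Proof. by move=> tT; apply/prodf_neq0 => i _; rewrite expfz_neq0 ?tT. Qed.

Lemma laurent_differenceP (K : fieldType) (t : {ffun 'I_r -> K}) a b :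
  torus K r t ->
  laurent_monomial t (exponent_vector a - exponent_vector b) = 1 <->
  'X_[a].@[t] = 'X_[b].@[t].
Proof.
move=> tT; rewrite laurent_monomialB // -!laurent_exponent_vector.
have b_neq0 := laurent_monomial_neq0 (exponent_vector b) tT.
by split=> [/divr1_eq|->]; rewrite ?divff.
Qed.

End Exponents.

(** * Monoids of orbits in the torus *)

Section ToricMonoid.
Variables (K : fieldType) (n r : nat) (phi : 'M[int]_(r, n)).
Variables (A : zmodType) (beta : {additive 'cV[int]_r -> A}).
Variable Y : set (set {ffun 'I_r -> K}).
Hypothesis Y_monoid : is_submonoid phi (torus_orbits K phi) Y.

(** The condition on beta does not follow from the other one: over a finite
    field, two monomials of different degrees may agree on all K-points of the
    torus, and their difference need not lie in I(Y). *)
Definition vanishing_lattice : set 'cV[int]_r :=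
  [set m | beta m = 0 /\
     forall t, (\bigcup_(O in Y) O) t -> laurent_monomial t m = 1].

Lemma torus_orbit_points t : (\bigcup_(O in Y) O) t -> torus K r t.
Proof.
case: Y_monoid => Y_torus _ _ [_ /Y_torus[s sT <-] [g [gT _] <-]] i.
by rewrite ffunE mulf_neq0 ?gT ?sT.
Qed.

Lemma vanishing_lattice_is_lattice : is_lattice vanishing_lattice.
Proof.
split=> [|x y [beta_x x1] [beta_y y1]]; split.
- exact: raddf0.
- move=> t _; rewrite /laurent_monomial big1 // => i _.
  by rewrite mxE expr0z.
- by rewrite raddfB beta_x beta_y subrr.
- move=> t tY; rewrite laurent_monomialB; last exact: torus_orbit_points.
  by rewrite x1 // y1 // divr1.
Qed.

Lemma binomial_latticeP a b :
  vanishing_lattice (exponent_vector a - exponent_vector b) <->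
  cox_homogeneous beta ('X_[K, a] - 'X_[b]) /\
  vanishes_on ('X_[K, a] - 'X_[b]) Y.
Proof.
rewrite binomial_homogeneousP binomial_vanishesP !cox_degreeE.
rewrite /vanishing_lattice /= raddfB; split=> -[beta_ab eq_ab]; split.
- exact: subr0_eq.
- move=> t tY; apply/(laurent_differenceP _ _ (torus_orbit_points tY)).
  exact: eq_ab.
- by rewrite beta_ab subrr.
- move=> t tY; apply/(laurent_differenceP _ _ (torus_orbit_points tY)).
  exact: eq_ab.
Qed.

Lemma toric_vanishing_ideal :
  vanishing_ideal beta Y = lattice_ideal K vanishing_lattice.
Proof.
rewrite (vanishing_ideal_binomials beta Y_monoid); apply: ideal_gen_eq => f.
- move=> [[a [b ->]] hom van]; have [c ->] := binomial_factor K a b.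
  apply/ideal_genMl/ideal_gen_mem; eexists; last by [].
  exact/binomial_latticeP.
- move=> [m Lm <-]; apply: ideal_gen_mem.
  have /binomial_latticeP[hom van] :
      vanishing_lattice
        (exponent_vector (pos_part m) - exponent_vector (neg_part m)).
    by rewrite pos_neg_partK.
  by split=> //; exists (pos_part m), (neg_part m).
Qed.

End ToricMonoid.

Theorem proposition2p6
    (R : realType) (K : fieldType) (n r : nat)
    (Sigma : set (set 'rV[R]_n)) (phi : 'M[int]_(r, n))
    (A : zmodType) (beta : {additive 'cV[int]_r -> A})
    (Sigma_fan : is_fan Sigma)
    (Sigma_simplicial : simplicial_fan Sigma)
    (Sigma_complete : complete_fan Sigma)
    (phi_rays : ray_generators Sigma phi)
    (phi_beta_exact : class_group_sequence phi beta)
    (torsion_char : torsion_coprime_char A K)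
    (proj_surj : torus_proj_surjective K phi)
    (Y : set (set {ffun 'I_r -> K}))
    (Y_sub_X : Y `<=` toric_points K phi Sigma) :
  (is_submonoid phi (toric_points K phi Sigma `|` irrelevant_orbits K phi Sigma) Y ->
     binomial_ideal (vanishing_ideal beta Y)) /\
  (is_submonoid phi (torus_orbits K phi) Y ->
     exists2 L : set 'cV[int]_r,
       is_lattice L & vanishing_ideal beta Y = lattice_ideal K L).
Proof.
split=> [Y_monoid|Y_monoid].
- rewrite (vanishing_ideal_binomials beta Y_monoid).
  by eexists; last reflexivity; move=> f [].
- exists (vanishing_lattice beta Y).
  + exact: (vanishing_lattice_is_lattice beta Y_monoid).
  + exact: (toric_vanishing_ideal beta Y_monoid).
Qed.
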